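(* Let $n,m$ be positive integers and let $G$ be a simple graph. Then $G$ is isomorphic to the complete bipartite graph $K_{n,m}$ if and only if $$da(G;x,y) = nxy^{n} + mxy^{m} + y^{n+m}\sum_{i=1}^{n}\sum_{j=1}^{m} \binom{n}{i}\binom{m}{j} x^{i+j}y^{\min\{2i-n,\,2j-m\}}.$$
   Context: All graphs are finite, simple and have at least one vertex. For a graph $G$, $S\subseteq V(G)$ and $u\in V(G)$, let $\bar S=V(G)\setminus S$, let $\delta_S(u)=|\{v\in S:\{u,v\}\in E(G)\}|$, and let $G[S]$ be the subgraph induced by $S$. The defensive alliance polynomial of $G$ is $$da(G;x,y)=\sum_{S} x^{|S|}\,y^{f_y(S)},\qquad f_y(S)=\min_{u\in S}\bigl(\delta_S(u)-\delta_{\bar S}(u)+|V(G)|\bigr),$$ where the sum runs over all non-empty $S\subseteq V(G)$ such that $G[S]$ is connected (single-vertex graphs are connected). *)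

(* Defs.v *)
From HB Require Import structures.
From mathcomp Require Import all_boot all_order all_algebra.

Set Implicit Arguments.
Unset Strict Implicit.
Unset Printing Implicit Defensive.

Import Order.TTheory GRing.Theory Num.Theory.
Local Open Scope ring_scope.

Record sgraph := SGraph {
  vertex :> finType;
  adj : rel vertex;
  adj_sym : symmetric adj;
  adj_irrefl : irreflexive adj }.

Definition isomorphic (G H : sgraph) : Prop :=
  exists2 f : G -> H, bijective f & forall u v, adj (f u) (f v) = adj u v.

Definition bip_adj (n m : nat) : rel ('I_n + 'I_m)%type :=
  fun u v => match u, v with
             | inl _, inr _ | inr _, inl _ => true
             | _, _ => false
             end.

Lemma bip_adj_sym n m : symmetric (@bip_adj n m).
Proof. by case=> [?|?] []. Qed.

Lemma bip_adj_irrefl n m : irreflexive (@bip_adj n m).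
Proof. by case. Qed.

Definition complete_bipartite (n m : nat) : sgraph :=
  SGraph (@bip_adj_sym n m) (@bip_adj_irrefl n m).

Section DefensiveAlliance.
Variable G : sgraph.
Implicit Types (S : {set G}) (u v : G).

Definition deg_in S u : nat := #|[set v in S | adj u v]|.

Definition induced_adj S : rel G :=
  fun u v => [&& u \in S, v \in S & adj u v].

Definition induced_connected S : bool :=
  [forall u in S, forall v in S, connect (induced_adj S) u v].

(* The natural-number subtraction never truncates: deg_in (~: S) u <= #|G|. *)
Definition alliance_value S u : nat :=
  (deg_in S u + #|G| - deg_in (~: S) u)%N.

(* Every alliance_value is at most 2 * #|G|, so for non-empty S the default
   value of the iterated minimum is irrelevant; see fyP. *)
Definition fy S : nat := \big[minn/(2 * #|G|)%N]_(u in S) alliance_value S u.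

Lemma alliance_valueE S u :
  (alliance_value S u)%:Z = (deg_in S u)%:Z - (deg_in (~: S) u)%:Z + #|G|%:Z.
Proof.
rewrite /alliance_value -subzn ?PoszD; first by rewrite addrAC.
exact: leq_trans (max_card _) (leq_addl _ _).
Qed.

Lemma fyP S : S != set0 ->
  (exists2 u, u \in S & fy S = alliance_value S u) /\
  (forall u, u \in S -> (fy S <= alliance_value S u)%N).
Proof.
move=> /set0Pn[u0 u0S].
have le_fy u : u \in S -> (fy S <= alliance_value S u)%N.
  move=> uS; rewrite /fy -big_filter.
  have: u \in [seq i <- index_enum G | i \in S] by rewrite mem_filter uS mem_index_enum.
  elim: [seq _ <- _ | _] => //= v s IH; rewrite inE big_cons => us.
  case/predU1P: us => [<-|/IH le_u]; first exact: geq_minl.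
  by rewrite geq_min le_u orbT.
split=> //; have [u uS min_u] := arg_minnP (alliance_value S) u0S.
exists u => //; apply/eqP; rewrite eqn_leq le_fy //=.
rewrite /fy; apply: (big_ind (fun k => alliance_value S u <= k)%N) => //.
  rewrite /alliance_value mul2n -addnn; apply: leq_trans (leq_subr _ _) _.
  by rewrite leq_add2r max_card.
by move=> a b ha hb; rewrite leq_min ha.
Qed.

(* Bivariate polynomials are Z[y][x]: x is the outer indeterminate. *)
Definition da : {poly {poly int}} :=
  \sum_(S : {set G} | (S != set0) && induced_connected S)
     'X ^+ #|S| * 'X%:P ^+ fy S.

End DefensiveAlliance.

(* Since min(2i-n, 2j-m) can be negative, the identity is stated between
   rational functions, where y has integer powers. *)
Notation "p %:F" := (FracField.tofrac p) : ring_scope.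

Definition xvar : {fraction {poly {poly int}}} := 'X%:F.
Definition yvar : {fraction {poly {poly int}}} := 'X%:P%:F.

(* Main.v *)
(* In a clique S of vertices of degree d, every vertex u of S has
   delta_S(u) - delta_{V-S}(u) + |V| = 2(|S| - 1) + |V| - d, so S contributes
   x^|S| y^(2(|S| - 1) + |V| - d) to da(G).
   The coefficient of x recovers |V| = n + m and the degrees: n vertices of
   degree m and m vertices of degree n.
   - If n < m, an edge between two vertices of degree n would contribute
     x^2 y^(m+2), whereas the only x^2 term on the right is nm x^2 y^(n+2).
     So the m vertices of degree n are independent, hence each is adjacent to
     all the n others, whose degree m is thereby exhausted.
   - If n = m, a triangle would contribute x^3 y^(n+4), whereas the x^3 terms
     on the right are multiples of x^3 y^(n+2).  So G is triangle-free and
     n-regular on 2n vertices: the disjoint neighbourhoods of the two ends of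
     an edge cover G, which forces G to be complete bipartite. *)
Require Import Defs.
From HB Require Import structures.
From mathcomp Require Import all_boot all_order all_algebra.
From mathcomp Require Import zify.

Set Implicit Arguments.
Unset Strict Implicit.
Unset Printing Implicit Defensive.

Import Order.TTheory GRing.Theory Num.Theory.
Local Open Scope ring_scope.

(** * Alliance values of cliques and coefficients of [da G] *)

Definition nbhd (G : sgraph) (u : G) : {set G} := [set v | adj u v].

Definition clique (G : sgraph) (S : {set G}) : Prop :=
  {in S &, forall u v, u != v -> adj u v}.

Section Alliance.
Variable G : sgraph.
Implicit Types (S : {set G}) (u v : G).

Lemma deg_inE S u : deg_in S u = #|S :&: nbhd u|.
Proof. by rewrite /deg_in; congr #|pred_of_set _|; apply/setP=> v; rewrite !inE. Qed.

(** The neighbourhood of [u] splits into its parts inside and outside [S], so the outer degree is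
    the full degree minus [deg_in S u]. *)
Lemma alliance_value_deg S u :
  (alliance_value S u = 2 * deg_in S u + #|G| - #|nbhd u|)%N.
Proof.
have := cardsID S (nbhd u); rewrite /alliance_value !deg_inE.
rewrite setDE ![nbhd u :&: _]setIC => <-.
lia.
Qed.

Lemma fy_const S k : S != set0 ->
  {in S, forall u, alliance_value S u = k} -> fy S = k.
Proof. by move=> /fyP[[u uS ->] _]; apply. Qed.

Lemma clique_connected S : clique S -> induced_connected S.
Proof.
move=> clS; apply/forall_inP=> u uS; apply/forall_inP=> v vS.
have [->|neq_uv] := eqVneq u v; first exact: connect0.
by apply: connect1; rewrite /induced_adj uS vS clS.
Qed.

Lemma deg_in_clique S u : clique S -> u \in S -> deg_in S u = #|S|.-1.
Proof.
move=> clS uS; rewrite (cardsD1 u S) uS /= deg_inE; congr #|pred_of_set _|.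
apply/setP=> v; rewrite !inE andbC; case: (eqVneq v u) => [->|neq_vu] /=.
  by rewrite adj_irrefl.
by case vS: (v \in S); rewrite ?andbF // clS // eq_sym.
Qed.

Lemma fy_clique S d : S != set0 -> clique S ->
  {in S, forall u, #|nbhd u| = d} -> fy S = (2 * #|S|.-1 + #|G| - d)%N.
Proof.
move=> S0 clS degS; apply: fy_const => // u uS.
by rewrite alliance_value_deg deg_in_clique // degS.
Qed.

Lemma clique1 u : clique [set u].
Proof. by move=> v w /set1P-> /set1P->; rewrite eqxx. Qed.

Lemma clique2 u v : adj u v -> clique [set u; v].
Proof.
by move=> uv x y /set2P[]-> /set2P[]->; rewrite ?eqxx // => _; rewrite ?uv // adj_sym.
Qed.

Lemma coef_da k l : (da G)`_k`_l =
  #|[set S : {set G} | [&& S != set0, induced_connected S, #|S| == k & fy S == l]]|%:R.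
Proof.
rewrite /da coef_sum coef_sum -sum1_card natr_sum.
rewrite [RHS]big_mkcond [LHS]big_mkcond; apply: eq_bigr => S _; rewrite inE.
rewrite -polyC_exp mulrC coefCM coefXn andbA; case: (_ && _) => //=; rewrite eq_sym; case: eqP => //= _.
  by rewrite mulr1 coefXn eq_sym; case: eqP.
by rewrite mulr0 coef0.
Qed.

(** Coefficients of [da G] count vertex sets, so contributions never cancel and the single set [S]
    suffices. *)
Lemma coef_da_neq0 S : S != set0 -> induced_connected S ->
  (da G)`_#|S|`_(fy S) != 0.
Proof.
move=> S0 cS; rewrite coef_da pnatr_eq0 cards_eq0.
by apply/set0Pn; exists S; rewrite inE S0 cS !eqxx.
Qed.

(** Singletons alone produce the part linear in x, where the degrees can be read off; the larger
    connected sets will match the double sum. *)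
Lemma da_split1 : da G = \sum_(u : G) 'X * 'X%:P ^+ (#|G| - #|nbhd u|)
  + \sum_(S : {set G} | (1 < #|S|)%N && induced_connected S) 'X^#|S| * 'X%:P ^+ fy S.
Proof.
have singleton u : [/\ [set u] != set0, induced_connected [set u] &
    fy [set u] = (#|G| - #|nbhd u|)%N].
  have u0 : [set u] != set0 by rewrite -card_gt0 cards1.
  split=> //; first exact: clique_connected (@clique1 u).
  rewrite (@fy_clique _ #|nbhd u|) ?cards1 //; first exact: clique1.
  by move=> v /set1P->.
have singletonP S : (S \in [set [set u] | u : G]) = (#|S| == 1)%N.
  by apply/imsetP/cards1P => -[u]; exists u.
rewrite /da (bigID [in [set [set u] | u : G]]) /=; congr (_ + _); last first.
  apply: eq_bigl => S; rewrite singletonP -card_gt0 andbAC; congr (_ && _); lia.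
rewrite (eq_bigl [in [set [set u] | u : G]]) => [|S]; last first.
  by rewrite andb_idl // => /imsetP[u _ ->]; have [-> ->] := singleton u.
rewrite big_imset /=; last by move=> u v _ _; apply: set1_inj.
by apply: eq_bigr => u _; have [_ _ ->] := singleton u; rewrite cards1.
Qed.

Lemma coef1_da : (da G)`_1 = \sum_(u : G) 'X^(#|G| - #|nbhd u|).
Proof.
rewrite da_split1 coefD !coef_sum [X in _ + X]big1 ?addr0 => [|S /andP[S1 _]].
  by apply: eq_bigr => u _; rewrite -polyC_exp mulrC coefCM coefX mulr1.
by rewrite -polyC_exp mulrC coefCM coefXn (ltn_eqF S1) mulr0.
Qed.

End Alliance.

(** * The right-hand side as a polynomial, and its coefficients *)

(* The right-hand side of the theorem with y^(n+m) multiplied in: since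
   n + m + min(2i-n, 2j-m) = min(2i+m, 2j+n), all exponents become natural. *)
Definition bip_da (n m : nat) : {poly {poly int}} :=
  n%:R * 'X * 'X%:P ^+ n + m%:R * 'X * 'X%:P ^+ m
  + \sum_(1 <= i < n.+1) \sum_(1 <= j < m.+1)
      'C(n, i)%:R * 'C(m, j)%:R * 'X^(i + j)
      * 'X%:P ^+ minn (2 * i + m) (2 * j + n).

Lemma exp_shift_min (F : fieldType) (y : F) (n m i j : nat) : y != 0 ->
  y ^+ minn (2 * i + m) (2 * j + n) =
  y ^+ (n + m) * y ^ Num.min ((2 * i)%N%:Z - n%:Z) ((2 * j)%N%:Z - m%:Z).
Proof.
by move=> y0; rewrite (exprnP y (n + m)) -expfzDr // exprnP; congr (_ ^ _); lia.
Qed.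

Lemma tofrac_bip_da n m : (bip_da n m)%:F =
    n%:R * xvar * yvar ^+ n + m%:R * xvar * yvar ^+ m
    + yvar ^+ (n + m) *
      \sum_(1 <= i < n.+1) \sum_(1 <= j < m.+1)
        'C(n, i)%:R * 'C(m, j)%:R * xvar ^+ (i + j)
        * yvar ^ Num.min ((2 * i)%N%:Z - n%:Z) ((2 * j)%N%:Z - m%:Z).
Proof.
have y0 : yvar != 0 by rewrite tofrac_eq0 polyC_eq0 polyX_eq0.
rewrite /bip_da !(rmorphD, rmorphM, rmorphXn, rmorph_nat) rmorph_sum /=.
congr (_ + _); rewrite big_distrr; apply: eq_bigr => i _ /=.
rewrite rmorph_sum big_distrr; apply: eq_bigr => j _ /=.
rewrite !(rmorphM, rmorphXn, rmorph_nat) /= -/xvar -/yvar mulrCA; congr (_ * _).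
exact: exp_shift_min.
Qed.

Lemma coef_term (c k l k' : nat) :
  (c%:R * 'X^k * 'X%:P ^+ l : {poly {poly int}})`_k' = 'X^l *+ (c * (k' == k)).
Proof.
rewrite -polyC_exp mulrC coefCM mulr_natl coefMn coefXn.
by rewrite mulrnAr mulr_natr -mulrnA mulnC.
Qed.

Lemma coef1_bip_da n m : (bip_da n m)`_1 = 'X^n *+ n + 'X^m *+ m.
Proof.
rewrite /bip_da !coefD coef_sum [X in _ + X]big_nat_cond big1 ?addr0.
  by rewrite -['X]expr1 !coef_term !muln1.
move=> i /andP[/andP[i1 _] _]; rewrite coef_sum big_nat_cond big1 //.
move=> j /andP[/andP[j1 _] _]; rewrite -natrM coef_term.
by rewrite (_ : _ == _ = false) ?muln0 //; lia.
Qed.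

(** For [1 < k] the two terms linear in x drop out, so a nonzero coefficient can only come from a
    term of the double sum. *)
Lemma coef_bip_da_neq0 n m k l : (1 < k)%N -> (bip_da n m)`_k`_l != 0 ->
  exists i j, [/\ (0 < i)%N, (0 < j)%N, k = (i + j)%N &
    l = minn (2 * i + m) (2 * j + n)].
Proof.
move=> k1; pose E i j := [&& 0 < i, 0 < j, k == i + j & l == minn (2 * i + m) (2 * j + n)]%N.
have [/hasP[i _ /hasP[j _ /and4P[i0 j0 /eqP kE /eqP lE]]]|noE] :=
   boolP (has (fun i => has (E i) (index_iota 1 m.+1)) (index_iota 1 n.+1)).
  by exists i, j.
case/eqP; rewrite /bip_da !coefD !coef_sum -['X]expr1 !coef_term.
rewrite (_ : k == 1%N = false) ?muln0 ?mulr0n ?coef0 ?add0r; last by lia.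
rewrite big_seq big1 // => i iI; rewrite !coef_sum big_seq big1 // => j jI.
have := hasPn (hasPn noE i iI) j jI; move: iI jI; rewrite !mem_index_iota => iI jI.
rewrite -natrM coef_term /E.
case: (k =P _) => [_|_]; last by rewrite muln0 mulr0n coef0.
rewrite coefMn coefXn; case: (l =P _) => [_|_]; last by rewrite mul0rn.
lia.
Qed.

(** * The polynomial of a complete bipartite graph *)

Lemma connected_nbhd (G : sgraph) (S : {set G}) u :
  (1 < #|S|)%N -> induced_connected S -> u \in S -> S :&: nbhd u != set0.
Proof.
move=> S1 cS uS; have /set0Pn[v /setD1P[neq_vu vS]] : S :\ u != set0.
  by rewrite -card_gt0; move: S1; rewrite (cardsD1 u S) uS.
have /connectP[[|w p] /=] := forall_inP (forall_inP cS u uS) v vS.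
  by move=> _ vu; rewrite vu eqxx in neq_vu.
by case/andP=> /and3P[_ wS uw] _ _; apply/set0Pn; exists w; rewrite !inE wS.
Qed.

Definition complete_bipartition (G : sgraph) (A : {set G}) : Prop :=
  forall u, nbhd u = if u \in A then ~: A else A.

Lemma complete_bipartitionC (G : sgraph) (A : {set G}) :
  complete_bipartition A -> complete_bipartition (~: A).
Proof. by move=> bA u; rewrite bA !inE setCK; case: (u \in A). Qed.

Section Bipartition.
Variables (G : sgraph) (A : {set G}).
Hypothesis bA : complete_bipartition A.
Implicit Type S : {set G}.

Lemma alliance_value_bip S u : alliance_value S u =
  if u \in A then (2 * #|S :\: A| + #|A|)%N else (2 * #|S :&: A| + #|~: A|)%N.
Proof.
rewrite alliance_value_deg deg_inE bA -(cardsC A) setDE; case: (u \in A); lia.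
Qed.

(** The alliance value depends only on the side of the vertex, and [S] meets both sides, so the
    minimum is over exactly two numbers. *)
Lemma fy_bip S : S :&: A != set0 -> S :\: A != set0 ->
  fy S = minn (2 * #|S :&: A| + #|~: A|) (2 * #|S :\: A| + #|A|).
Proof.
move=> /set0Pn[a /setIP[aS aA]] /set0Pn[b /setDP[bS bNA]].
have [|[u uS fyE] le_fy] := @fyP G S; first by apply/set0Pn; exists a.
apply/eqP; rewrite eqn_leq; apply/andP; split.
  have := le_fy _ aS; have := le_fy _ bS.
  by rewrite leq_min !alliance_value_bip aA (negPf bNA) => -> ->.
by rewrite fyE alliance_value_bip; case: ifP => _; [exact: geq_minr | exact: geq_minl].
Qed.

(** A connected set with two vertices contains an edge, and every edge crosses between the sides.
    Conversely, two vertices on one side are joined through any vertex of [S] on the other. *)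
Lemma connected_bip S : (1 < #|S|)%N && induced_connected S =
  (S :&: A != set0) && (S :\: A != set0).
Proof.
apply/andP/andP => [[S1 cS]|[/set0Pn[a /setIP[aS aA]] /set0Pn[b /setDP[bS bNA]]]].
  have /set0Pn[u uS] : S != set0 by rewrite -card_gt0 ltnW.
  have := connected_nbhd S1 cS uS; rewrite bA setDE; case: ifPn => uA -> ; split=> //.
    by apply/set0Pn; exists u; rewrite inE uS.
  by apply/set0Pn; exists u; rewrite !inE uS.
have adjE u v : adj u v = (u \in A) (+) (v \in A).
  by have /setP/(_ v) := bA u; rewrite inE => ->; case: (u \in A); rewrite ?inE.
split.
  rewrite (cardsD1 a S) aS (cardsD1 b (S :\ a)) !inE bS andbT.
  by case: eqVneq => // ba; rewrite ba aA in bNA.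
have conn1 u v : u \in S -> v \in S -> adj u v -> connect (induced_adj S) u v.
  by move=> uS vS uv; apply: connect1; rewrite /induced_adj uS vS.
apply/forall_inP=> u uS; apply/forall_inP=> v vS.
have [uv|] := boolP (adj u v); first exact: conn1.
(* [w] lies in [S] opposite to [u]; as [v] is not adjacent to [u], it is on the side of [u], so [w]
   is adjacent to both. *)
pose w := if u \in A then b else a.
have wS : w \in S by rewrite /w; case: ifP.
rewrite adjE => uv; apply: (connect_trans (y := w)); apply: conn1 => //.
  by rewrite adjE /w; case: ifP; rewrite ?aA ?(negPf bNA).
by move: uv; rewrite adjE /w; case: (u \in A); rewrite ?aA ?(negPf bNA); case: (v \in A).
Qed.

(** Subsets [S] correspond bijectively to the pairs of their traces on [A] and its complement, and
    the binomials count the traces of given sizes. *)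
Lemma sum_cards_bip (R : nmodType) (F : nat -> nat -> R) :
  \sum_(S : {set G} | (S :&: A != set0) && (S :\: A != set0)) F #|S :&: A| #|S :\: A|
  = \sum_(1 <= i < #|A|.+1) \sum_(1 <= j < #|~: A|.+1)
      F i j *+ ('C(#|A|, i) * 'C(#|~: A|, j)).
Proof.
pose D k (B : {set G}) := [set C : {set G} | C \subset B & #|C| == k].
have countS i j : #|[set S : {set G} | (#|S :&: A| == i) && (#|S :\: A| == j)]| =
    ('C(#|A|, i) * 'C(#|~: A|, j))%N.
  rewrite -!cards_draws -cardsX -/(D i A) -/(D j (~: A)).
  pose join (p : {set G} * {set G}) := p.1 :|: p.2.
  have joinK : {in setX (D i A) (D j (~: A)), cancel join (fun S => (S :&: A, S :\: A))}.
    case=> B C /setXP[/=]; rewrite !inE /join => /andP[BA _] /andP[CA _] /=.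
    rewrite setIUl setDUl (setIidPl BA) (_ : C :&: A = set0) ?setU0; last first.
      by apply/eqP; rewrite setI_eq0 disjoints_subset.
    rewrite (_ : B :\: A = set0) ?set0U; last by apply/eqP; rewrite setD_eq0.
    by rewrite setDE (setIidPl CA).
  rewrite -(card_in_imset (can_in_inj joinK)); congr #|pred_of_set _|.
  apply/setP=> S; rewrite inE; apply/andP/imsetP => [[iS jS]|[[B C] BC ->]].
    exists (S :&: A, S :\: A); last by rewrite /join /= setID.
    by rewrite !inE /= iS jS subsetIr setDE subsetIr.
  have [-> ->] := joinK _ BC.
  by move: BC; rewrite !inE /= => /andP[/andP[_ ->] /andP[_ ->]].
(* Each [S] is filed under its one pair of trace sizes, so that the sums can be exchanged; starting
   both ranges at 1 encodes that both traces are non-empty. *)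
transitivity (\sum_(S : {set G}) \sum_(1 <= i < #|A|.+1) \sum_(1 <= j < #|~: A|.+1)
    if (#|S :&: A| == i) && (#|S :\: A| == j) then F i j else 0).
  rewrite big_mkcond; apply: eq_bigr => S _.
  transitivity (\sum_(1 <= i < #|A|.+1 | i == #|S :&: A|)
      \sum_(1 <= j < #|~: A|.+1 | j == #|S :\: A|) F i j).
    rewrite !big_nat1_eq -!card_gt0 !ltnS subset_leq_card ?subsetIr // andbT.
    rewrite subset_leq_card ?setDE ?subsetIr // andbT -setDE.
    by case: (0 < _)%N; case: (0 < _)%N.
  rewrite big_mkcond; apply: eq_bigr => i _; rewrite eq_sym.
  case: eqP => _ /=; last by rewrite big1.
  by rewrite big_mkcond; apply: eq_bigr => j _; rewrite eq_sym.
rewrite exchange_big; apply: eq_bigr => i _.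
rewrite exchange_big; apply: eq_bigr => j _.
by rewrite -countS -sumr_const [RHS]big_mkcond; apply: eq_bigr => S _; rewrite inE.
Qed.

Lemma da_bip : da G = bip_da #|A| #|~: A|.
Proof.
rewrite da_split1 (eq_bigl _ _ connected_bip) /bip_da; congr (_ + _).
  rewrite (bigID [in A]) /=; congr (_ + _).
    rewrite (eq_bigr (fun=> 'X * 'X%:P ^+ #|A|)) => [|u uA]; last first.
      by rewrite bA uA -(cardsC A) addnK.
    by rewrite sumr_const -mulrA mulr_natl.
  rewrite (eq_bigr (fun=> 'X * 'X%:P ^+ #|~: A|)) => [|u /negPf uA]; last first.
    by rewrite bA uA -(cardsC A) addKn.
  rewrite (eq_bigl [in ~: A]) => [|u]; last by rewrite inE.
  by rewrite sumr_const -mulrA mulr_natl.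
pose F i j : {poly {poly int}} :=
  'X^(i + j) * 'X%:P ^+ minn (2 * i + #|~: A|) (2 * j + #|A|).
transitivity (\sum_(S : {set G} | (S :&: A != set0) && (S :\: A != set0)) F #|S :&: A| #|S :\: A|).
  by apply: eq_bigr => S /andP[SA SNA]; rewrite fy_bip // /F cardsID.
rewrite sum_cards_bip; apply: eq_bigr => i _; apply: eq_bigr => j _.
by rewrite -natrM -mulrA mulr_natl.
Qed.

End Bipartition.

(** * Isomorphism with the complete bipartite graph as a bipartition *)

Lemma isomorphic_bipP (G : sgraph) (n m : nat) :
  isomorphic G (complete_bipartite n m) <->
  exists2 A : {set G}, complete_bipartition A & #|A| = n /\ #|~: A| = m.
Proof.
split=> [[f [g fK gK] f_adj]|[A bA [cA cNA]]].
  pose isl (x : 'I_n + 'I_m) := if x is inl _ then true else false.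
  have injg := can_inj gK.
  exists [set u | isl (f u)] => [u|].
    apply/setP=> v; rewrite !inE -f_adj /=.
    by case: (f u) => ? /=; rewrite !inE; case: (f v).
  split; rewrite -[RHS]card_ord -cardsT.
    rewrite -(card_imset _ (inj_comp injg (@inl_inj _ _))); congr #|pred_of_set _|.
    apply/setP=> u; rewrite inE; apply/idP/imsetP=> [|[a _ ->]]; last by rewrite /= gK.
    by case E: (f u) => [a|] //= _; exists a; rewrite // -E fK.
  rewrite -(card_imset _ (inj_comp injg (@inr_inj _ _))); congr #|pred_of_set _|.
  apply/setP=> u; rewrite !inE; apply/idP/imsetP=> [|[a _ ->]]; last by rewrite /= gK.
  by case E: (f u) => [|a] //= _; exists a; rewrite // -E fK.
(* [g] enumerates [A] on the left summand and its complement on the right; it is injective between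
   types of equal size, hence bijective. *)
pose g (x : 'I_n + 'I_m) : G := match x with
  | inl i => enum_val (cast_ord (esym cA) i)
  | inr j => enum_val (cast_ord (esym cNA) j) end.
have gA x : (g x \in A) = if x is inl _ then true else false.
  by case: x => i /=; [|apply: negbTE; rewrite -in_setC]; apply: enum_valP.
have injg : injective g.
  move=> x y gxy; have := gA y; rewrite -gxy gA.
  by case: x y gxy => i [] j //= /enum_val_inj/cast_ord_inj ->.
have [|f gK fK] := inj_card_bij injg; first by rewrite card_sum !card_ord -cA -cNA cardsC.
exists f => [|u v]; first by exists g.
rewrite -[in RHS](fK u) -[in RHS](fK v).
have /setP/(_ (g (f v))) := bA (g (f u)); rewrite inE => ->.
by rewrite gA /=; case: (f u) => ?; rewrite ?inE gA; case: (f v).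
Qed.

(** * Recovering the bipartition from the polynomial *)

Section Converse.
Variables (G : sgraph) (n m : nat).
Hypothesis daG : da G = bip_da n m.

Lemma card_bip_da : #|G| = (n + m)%N.
Proof.
(* At y = 1 every vertex contributes 1 to the coefficient of x. *)
have /(congr1 (horner^~ 1)) : (da G)`_1 = (bip_da n m)`_1 by rewrite daG.
rewrite coef1_da coef1_bip_da hornerD !hornerMn !hornerXn !expr1n.
rewrite horner_sum (eq_bigr (fun=> 1)) => [|u _]; last by rewrite hornerXn expr1n.
by rewrite sumr_const -natrD => /eqP; rewrite eqr_nat => /eqP.
Qed.

(** A vertex of degree d contributes y^(n+m-d) to the coefficient of x. The bound on [d] keeps the
    truncated subtraction injective, and for n = m the two counts add up. *)
Lemma card_degree d : (d <= n + m)%N ->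
  #|[set u : G | #|nbhd u| == d]| = (n * (d == m) + m * (d == n))%N.
Proof.
move=> led; have : (da G)`_1`_(n + m - d) = (bip_da n m)`_1`_(n + m - d) by rewrite daG.
rewrite coef1_da coef1_bip_da coef_sum coefD !coefMn !coefXn -!mulrnA -natrD.
rewrite (eq_bigr (fun u : G => if #|nbhd u| == d then 1 else 0)) => [|u _]; last first.
  have := max_card (nbhd u); rewrite coefXn card_bip_da => led'.
  by rewrite (_ : (_ == _ :> nat) = (#|nbhd u| == d)); [case: eqP | lia].
rewrite -big_mkcond sumr_const => /eqP; rewrite eqr_nat cardsE => /eqP ->; lia.
Qed.

(** The monomial contributed by the clique must occur on the right; both exclusions below, of an
    edge and of a triangle, come from this. *)
Lemma clique_bip_da (S : {set G}) d : (1 < #|S|)%N -> clique S ->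
  {in S, forall u, #|nbhd u| = d} ->
  exists i j, [/\ (0 < i)%N, (0 < j)%N, #|S| = (i + j)%N &
    (2 * #|S|.-1 + (n + m) - d)%N = minn (2 * i + m) (2 * j + n)].
Proof.
move=> S1 clS degS; have S0 : S != set0 by rewrite -card_gt0 ltnW.
rewrite -card_bip_da -(fy_clique S0 clS degS).
by apply: coef_bip_da_neq0 => //; rewrite -daG coef_da_neq0 // clique_connected.
Qed.

Lemma da_bip_lt : (n < m)%N ->
  exists2 A : {set G}, complete_bipartition A & #|A| = n /\ #|~: A| = m.
Proof.
move=> ltnm; pose A := [set u : G | #|nbhd u| == m].
have cA : #|A| = n by rewrite card_degree; lia.
have cNA : #|~: A| = m by have := cardsC A; rewrite card_bip_da cA; lia.
have NAE : ~: A = [set u : G | #|nbhd u| == n].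
  apply/eqP; rewrite eq_sym eqEcard cNA card_degree ?leq_addr //.
  apply/andP; split; last by lia.
  by apply/subsetP=> u; rewrite !inE => /eqP->; rewrite neq_ltn ltnm.
have NA_indep u v : u \notin A -> v \notin A -> ~~ adj u v.
  move=> uA vA; apply/negP=> uv.
  have neq_uv : u != v by apply: contraTneq uv => ->; rewrite adj_irrefl.
  have [|||i [j]] := @clique_bip_da [set u; v] n; rewrite ?cards2 ?neq_uv //; first exact: clique2.
    by move=> w /set2P[]->; apply/eqP; [move: uA | move: vA]; rewrite -in_setC NAE inE.
  (* Here i = j = 1, so the exponent m + 2 would equal min(m + 2, n + 2) = n + 2. *)
  move=> [i0 j0 ijE]; lia.
have nbhd_NA u : u \notin A -> nbhd u = A.
  move=> uA; apply/eqP; rewrite eqEcard cA; apply/andP; split.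
    by apply/subsetP=> v; rewrite [v \in nbhd u]inE => uv; apply: contraTT uv; apply: NA_indep.
  by move: uA; rewrite -in_setC NAE inE => /eqP->.
exists A => // u; case: ifPn => [uA|]; last exact: nbhd_NA.
apply/eqP; rewrite eq_sym eqEcard cNA; apply/andP; split; last by move: uA; rewrite inE => /eqP->.
apply/subsetP=> v; rewrite inE => /nbhd_NA/setP/(_ u); by rewrite uA !inE adj_sym.
Qed.

Lemma da_bip_eq : n = m -> (0 < n)%N ->
  exists2 A : {set G}, complete_bipartition A & #|A| = n /\ #|~: A| = m.
Proof.
move=> eqnm n0; have deg (u : G) : #|nbhd u| = n.
  apply/eqP; have: u \in [set: G] by [].
  rewrite (_ : [set: G] = [set u : G | #|nbhd u| == n]) ?inE //; apply/esym/eqP.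
  by rewrite eqEcard subsetT cardsT card_bip_da card_degree; lia.
have disj (u v : G) : adj u v -> nbhd u \subset ~: nbhd v.
  move=> uv; apply/subsetP=> w; rewrite !inE => uw; apply/negP=> vw.
  have neq (x y : G) : adj x y -> x != y by apply: contraTneq => ->; rewrite adj_irrefl.
  have cS : #|[set u; v; w]| = 3%N.
    by rewrite -setUA cardsU1 cards2 !inE negb_or !neq.
  have [|||i [j]] := @clique_bip_da [set u; v; w] n; rewrite ?cS //.
    move=> x y; rewrite !inE => /orP[/orP[]|]/eqP-> /orP[/orP[]|]/eqP->;
      by rewrite ?eqxx // => _; rewrite // adj_sym.
  (* Here i and j are 1 and 2 in some order, so with n = m the exponent n + 4 would equal n + 2. *)
  move=> [i0 j0 ijE]; lia.
have [u _] : exists u, u \in [set: G].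
  by apply/set0Pn; rewrite -card_gt0 cardsT card_bip_da; lia.
have [v] : exists v, v \in nbhd u by apply/set0Pn; rewrite -card_gt0 deg.
rewrite inE => uv; pose A := nbhd v.
have cNA : #|~: A| = n by have := cardsC A; rewrite card_bip_da deg; lia.
have nbhd_u : nbhd u = ~: A by apply/eqP; rewrite eqEcard disj // cNA deg /=.
exists A; last by rewrite deg cNA.
(* A vertex in [A] is adjacent to [v], any other to [u]; [disj] then puts its neighbourhood inside
   the required side, and both have n elements. *)
move=> w; apply/eqP; rewrite eqEcard deg; case: ifPn => wA.
  by rewrite cNA leqnn andbT disj //; move: wA; rewrite inE adj_sym.
rewrite deg leqnn andbT -[A]setCK -nbhd_u disj //.
by move: wA; rewrite -in_setC -nbhd_u inE adj_sym.
Qed.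

End Converse.

Lemma bip_da_sym n m : bip_da n m = bip_da m n.
Proof.
rewrite /bip_da [_ + m%:R * _ * _]addrC; congr (_ + _).
rewrite exchange_big; apply: eq_bigr => i _; apply: eq_bigr => j _.
by rewrite minnC addnC [_%:R * _%:R]mulrC.
Qed.

Theorem proposition30 (n m : nat) (n_gt0 : (0 < n)%N) (m_gt0 : (0 < m)%N)
    (G : sgraph) (G_gt0 : (0 < #|G|)%N) :
  isomorphic G (complete_bipartite n m) <->
  (da G)%:F =
    n%:R * xvar * yvar ^+ n + m%:R * xvar * yvar ^+ m
    + yvar ^+ (n + m) *
      \sum_(1 <= i < n.+1) \sum_(1 <= j < m.+1)
        'C(n, i)%:R * 'C(m, j)%:R * xvar ^+ (i + j)
        * yvar ^ Num.min ((2 * i)%N%:Z - n%:Z) ((2 * j)%N%:Z - m%:Z).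
Proof.
rewrite isomorphic_bipP -tofrac_bip_da; split=> [[A bA [<- <-]]|/eqP].
  by rewrite (da_bip bA).
rewrite tofrac_eq => /eqP daG.
have [|ltmn|eqnm] := ltngtP n m; first exact: da_bip_lt; last exact: da_bip_eq.
(* The case m < n is the case n < m with the two sides exchanged. *)
rewrite bip_da_sym in daG; have [A bA [cA cNA]] := da_bip_lt daG ltmn.
by exists (~: A); [exact: complete_bipartitionC | rewrite setCK].
Qed.
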